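(* Let $A=(a_{ij})\in M_n(\mathbb{H})$ and let $\gamma\in[0,1]$. Then for any $p,q\in(1,\infty)$ with $\frac1p+\frac1q=1$, all the left eigenvalues of $A$ are contained in the union of the $n$ generalized balls $$B_i(A):=\left\{z\in\mathbb{H}: |z-a_{ii}|\le (n-1)^{\frac{1-\gamma}{q}}\,r_i(A)^{\gamma}\,\bigl(n_i^{(p)}(A)\bigr)^{1-\gamma}\right\},\qquad 1\le i\le n;$$ that is, $\Lambda_l(A)\subseteq B(A):=\bigcup_{i=1}^n B_i(A)$.
   Context: $\mathbb{H}$ is the skew field of real quaternions with its usual modulus $|\cdot|$, and $M_n(\mathbb{H})$ is the set of $n\times n$ quaternionic matrices. A quaternion $\lambda$ is a left eigenvalue of $A$ if $Ax=\lambda x$ for some nonzero column vector $x\in\mathbb{H}^n$; $\Lambda_l(A)$ is the set of left eigenvalues. $r_i(A):=\sum_{j\ne i}|a_{ij}|$ and $n_i^{(p)}(A):=\bigl(\sum_{j\neq i}|a_{ij}|^p\bigr)^{1/p}$. Convention: $0^0=1$. *)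

(* Defs.v *)
From HB Require Import structures.
From mathcomp Require Import all_boot all_order all_algebra.
From mathcomp Require Import ring.
From mathcomp Require Import all_classical all_reals all_analysis.

Set Implicit Arguments.
Unset Strict Implicit.
Unset Printing Implicit Defensive.

Import Order.TTheory GRing.Theory Num.Theory.

Local Open Scope classical_set_scope.
Local Open Scope ring_scope.

(* Quat a b c d stands for a + b i + c j + d k. *)
Record quat (R : Type) : Type :=
  Quat { qre : R; qimi : R; qimj : R; qimk : R }.

Section QuatChoice.
Variable R : choiceType.

Definition quat_tuple (x : quat R) : R * R * R * R :=
  (qre x, qimi x, qimj x, qimk x).

Definition tuple_quat (t : R * R * R * R) : quat R :=
  let: (a, b, c, d) := t in Quat a b c d.

Lemma quat_tupleK : cancel quat_tuple tuple_quat.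
Proof. by case. Qed.

HB.instance Definition _ := Choice.copy (quat R) (can_type quat_tupleK).

End QuatChoice.

Section QuatRing.
Variable R : realType.
Implicit Types x y z : quat R.

Definition qzero : quat R := Quat 0 0 0 0.

Definition qopp x : quat R := Quat (- qre x) (- qimi x) (- qimj x) (- qimk x).

Definition qadd x y : quat R :=
  Quat (qre x + qre y) (qimi x + qimi y) (qimj x + qimj y) (qimk x + qimk y).

Lemma qaddA : associative qadd.
Proof. by move=> x y z; rewrite /qadd /= !addrA. Qed.

Lemma qaddC : commutative qadd.
Proof. by move=> x y; congr Quat; rewrite addrC. Qed.

Lemma qadd0 : left_id qzero qadd.
Proof. by case=> a b c d; rewrite /qadd /= !add0r. Qed.

Lemma qaddN : left_inverse qzero qopp qadd.
Proof. by move=> x; rewrite /qadd /= !addNr. Qed.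

HB.instance Definition _ := GRing.isZmodule.Build (quat R)
  qaddA qaddC qadd0 qaddN.

Definition qone : quat R := Quat 1 0 0 0.

Definition qmul x y : quat R :=
  let: Quat a1 b1 c1 d1 := x in
  let: Quat a2 b2 c2 d2 := y in
  Quat (a1 * a2 - b1 * b2 - c1 * c2 - d1 * d2)
       (a1 * b2 + b1 * a2 + c1 * d2 - d1 * c2)
       (a1 * c2 - b1 * d2 + c1 * a2 + d1 * b2)
       (a1 * d2 + b1 * c2 - c1 * b2 + d1 * a2).

Lemma qmulA : associative qmul.
Proof. by case=> ? ? ? ? [? ? ? ?] [? ? ? ?] /=; congr Quat; ring. Qed.

Lemma qmul1l : left_id qone qmul.
Proof. by case=> ? ? ? ? /=; congr Quat; ring. Qed.

Lemma qmul1r : right_id qone qmul.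
Proof. by case=> ? ? ? ? /=; congr Quat; ring. Qed.

Lemma qmulDl : left_distributive qmul +%R.
Proof. by case=> ? ? ? ? [? ? ? ?] [? ? ? ?]; congr Quat => /=; ring. Qed.

Lemma qmulDr : right_distributive qmul +%R.
Proof. by case=> ? ? ? ? [? ? ? ?] [? ? ? ?]; congr Quat => /=; ring. Qed.

Lemma qone_neq0 : qone != 0.
Proof. by apply/eqP => -[] /eqP; rewrite oner_eq0. Qed.

HB.instance Definition _ := GRing.Zmodule_isNzRing.Build (quat R)
  qmulA qmul1l qmul1r qmulDl qmulDr qone_neq0.

Definition qnormsq x : R := qre x ^+ 2 + qimi x ^+ 2 + qimj x ^+ 2 + qimk x ^+ 2.

Definition qabs x : R := Num.sqrt (qnormsq x).

Lemma qnormsq_eq0 x : (qnormsq x == 0) = (x == 0).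
Proof.
case: x => a b c d; apply/eqP/eqP => [/eqP|[-> -> -> ->]]; last first.
  by rewrite /qnormsq /= !expr0n /= !addr0.
rewrite /qnormsq /= !paddr_eq0 ?addr_ge0 ?sqr_ge0 // !sqrf_eq0.
by case/andP => /andP[/andP[/eqP-> /eqP->] /eqP->] /eqP->.
Qed.

Definition qinv x : quat R :=
  let s := (qnormsq x)^-1 in
  Quat (s * qre x) (- (s * qimi x)) (- (s * qimj x)) (- (s * qimk x)).

Lemma qmulVr : {in predC1 (0 : quat R), left_inverse 1 qinv *%R}.
Proof.
move=> x; rewrite inE -qnormsq_eq0; case: x => a b c d.
rewrite /qnormsq /= => nz; congr Quat; rewrite /qnormsq /=; by field.
Qed.

Lemma qmulrV : {in predC1 (0 : quat R), right_inverse 1 qinv *%R}.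
Proof.
move=> x; rewrite inE -qnormsq_eq0; case: x => a b c d.
rewrite /qnormsq /= => nz; congr Quat; rewrite /qnormsq /=; by field.
Qed.

Lemma qunitP x y : y * x = 1 /\ x * y = 1 -> predC1 (0 : quat R) x.
Proof.
case=> yx1 _; apply/eqP => x0; move: yx1; rewrite x0 mulr0 => /esym/eqP.
by rewrite oner_eq0.
Qed.

Lemma qinv_out : {in [predC predC1 (0 : quat R)], qinv =1 id}.
Proof.
move=> x; rewrite !inE negbK => /eqP ->.
by congr Quat => /=; rewrite mulr0 ?oppr0.
Qed.

(* The units are exactly the nonzero elements: quat R is a skew field. *)
HB.instance Definition _ := GRing.NzRing_hasMulInverse.Build (quat R)
  qmulVr qmulrV qunitP qinv_out.

End QuatRing.

Section LeftSpectrum.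
Variables (R : realType) (n : nat).
Implicit Types A : 'M[quat R]_n.

(* l *: x multiplies every entry of x by l on the left. *)
Definition left_eigenvalues A : set (quat R) :=
  [set l | exists2 x : 'cV[quat R]_n, x != 0 & A *m x = l *: x].

Definition row_abs_sum A (i : 'I_n) : R := \sum_(j < n | j != i) qabs (A i j).

Definition row_pnorm (p : R) A (i : 'I_n) : R :=
  (\sum_(j < n | j != i) qabs (A i j) `^ p) `^ p^-1.

(* powR satisfies 0 `^ 0 = 1 and 0 `^ s = 0 for s != 0. *)
Definition gen_ball (p q gamma : R) A (i : 'I_n) : set (quat R) :=
  [set z | qabs (z - A i i) <=
     (n.-1%:R `^ ((1 - gamma) / q)) * (row_abs_sum A i `^ gamma)
       * (row_pnorm p A i `^ (1 - gamma))].

End LeftSpectrum.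

(* Main.v *)
Require Import Defs.
From mathcomp Require Import all_boot all_order all_algebra.
From mathcomp Require Import ring.
From mathcomp Require Import all_classical all_reals all_analysis.

Import Order.TTheory GRing.Theory Num.Theory.

Local Open Scope classical_set_scope.
Local Open Scope ring_scope.

(** Let [x] be an eigenvector for the left eigenvalue [l], and let [i] be an
    index at which [qabs (x i)] is largest. Row [i] of [A x = l x] reads
    [(l - A i i) x_i = \sum_(j != i) A i j x_j]; as the quaternionic modulus is
    multiplicative and subadditive, dividing by the positive number
    [qabs (x i)] gives the Gershgorin bound
    [qabs (l - A i i) <= row_abs_sum A i] ([left_gershgorin]).

    The radius of the generalized ball dominates the Gershgorin radius [r_i].
    Indeed Hoelder's inequality ([hoelder_sum]) against the constant family [1],
    on the [n - 1] indices [j != i], gives [r_i <= (n-1)^(1/q) n_i^(p)]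
    ([row_abs_sum_le_pnorm]). Splitting [r_i] as [r_i^gamma r_i^(1-gamma)] and
    applying this bound to the second factor only yields the stated radius. *)

Lemma qabs_ge0 (R : realType) (x : quat R) : 0 <= qabs x.
Proof. exact: sqrtr_ge0. Qed.

Lemma qnormsq_ge0 (R : realType) (x : quat R) : 0 <= qnormsq x.
Proof. by rewrite /qnormsq !addr_ge0 ?sqr_ge0. Qed.

Lemma sqr_qabs (R : realType) (x : quat R) : qabs x ^+ 2 = qnormsq x.
Proof. by rewrite /qabs sqr_sqrtr // qnormsq_ge0. Qed.

Lemma qabs0 (R : realType) : qabs (0 : quat R) = 0.
Proof. by rewrite /qabs /qnormsq /= !expr0n /= !addr0 sqrtr0. Qed.

Lemma qabs_eq0 (R : realType) (x : quat R) : (qabs x == 0) = (x == 0).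
Proof. by rewrite -sqrf_eq0 sqr_qabs qnormsq_eq0. Qed.

Lemma qabsM (R : realType) (x y : quat R) : qabs (x * y) = qabs x * qabs y.
Proof.
rewrite /qabs -sqrtrM ?qnormsq_ge0 //; congr Num.sqrt.
by case: x => a b c d; case: y => a' b' c' d'; rewrite /qnormsq /=; ring.
Qed.

(** Subadditivity reduces to the Cauchy-Schwarz inequality in R^4, which is
    read off Euler's four-square identity: the scalar product of [x] and [y] is
    the real part of [x] times the conjugate of [y], a quaternion whose squared
    modulus is [qnormsq x * qnormsq y]. *)
Lemma qabsD (R : realType) (x y : quat R) : qabs (x + y) <= qabs x + qabs y.
Proof.
rewrite -(@ler_pXn2r _ 2) ?nnegrE ?addr_ge0 ?qabs_ge0 // sqrrD !sqr_qabs.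
pose dot := qre x * qre y + qimi x * qimi y + qimj x * qimj y + qimk x * qimk y.
have -> : qnormsq (x + y) = qnormsq x + dot *+ 2 + qnormsq y.
  by rewrite /dot /qnormsq /=; ring.
rewrite lerD2r lerD2l lerMn2r /=; apply: le_trans (ler_norm dot) _.
rewrite -(@ler_pXn2r _ 2) ?nnegrE ?mulr_ge0 ?qabs_ge0 // real_normK ?num_real //.
rewrite exprMn !sqr_qabs.
(* The last three squares are the imaginary parts of x times conjugate of y. *)
have -> : qnormsq x * qnormsq y = dot ^+ 2
    + (qimi x * qre y - qre x * qimi y + qimk x * qimj y - qimj x * qimk y) ^+ 2
    + (qimj x * qre y - qre x * qimj y + qimi x * qimk y - qimk x * qimi y) ^+ 2
    + (qimk x * qre y - qre x * qimk y + qimj x * qimi y - qimi x * qimj y) ^+ 2.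
  by rewrite /dot /qnormsq; ring.
by rewrite -!addrA lerDl !addr_ge0 ?sqr_ge0.
Qed.

Lemma qabs_sum (R : realType) (I : Type) (s : seq I) (P : pred I)
    (F : I -> quat R) :
  qabs (\sum_(i <- s | P i) F i) <= \sum_(i <- s | P i) qabs (F i).
Proof.
elim/big_rec2: _ => [|i u v _ le_vu]; first by rewrite qabs0.
by apply: le_trans (qabsD _ _ _) _; rewrite lerD2l.
Qed.

(** Choosing the row where the eigenvector is largest in modulus lets every
    other coordinate be bounded by the one that multiplies [l - A i i]. *)
Lemma left_gershgorin (R : realType) (n : nat) (A : 'M[quat R]_n)
    (l : quat R) :
  left_eigenvalues A l -> exists i, qabs (l - A i i) <= row_abs_sum A i.
Proof.
case=> x /matrix0Pn[i0 [k]]; rewrite ord1 {k} => x0 Axl.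
case: (@arg_maxP _ _ _ i0 xpredT (fun i => qabs (x i 0)) isT) => i _ imax.
have xi_gt0 : 0 < qabs (x i 0).
  apply: lt_le_trans (imax i0 isT).
  by rewrite lt_neqAle qabs_ge0 eq_sym qabs_eq0 x0.
exists i; rewrite -(ler_pM2r xi_gt0) -qabsM.
have -> : (l - A i i) * x i 0 = \sum_(j < n | j != i) A i j * x j 0.
  have := congr1 (fun v : 'cV_n => v i 0) Axl.
  rewrite !mxE (bigD1 i) //= mulrBl => <-.
  by rewrite addrAC subrr add0r.
apply: le_trans (qabs_sum _ _ _ _ _) _; rewrite mulr_suml.
by apply: ler_sum => j _; rewrite qabsM ler_wpM2l ?qabs_ge0 //; exact: imax.
Qed.

Section Hoelder.
Variables (R : realType) (I : finType) (P : pred I).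

Lemma sum_powR_eq0 (a : I -> R) (p : R) :
  \sum_(i | P i) a i `^ p = 0 -> forall i, P i -> a i = 0.
Proof.
move=> /eqP; rewrite psumr_eq0 => [/allP sa0 i Pi|i _]; last exact: powR_ge0.
by have := sa0 i (mem_index_enum i); rewrite Pi => /eqP/powR_eq0_eq0.
Qed.

(** Young's inequality is applied termwise, after both families have been
    normalized to have [p]-norm, respectively [q]-norm, equal to [1]; the two
    sums on the right are then [p^-1] and [q^-1]. *)
Lemma hoelder_sum (a b : I -> R) (p q : R) :
  (forall i, 0 <= a i) -> (forall i, 0 <= b i) ->
  0 < p -> 0 < q -> p^-1 + q^-1 = 1 ->
  \sum_(i | P i) a i * b i <=
    (\sum_(i | P i) a i `^ p) `^ p^-1 * (\sum_(i | P i) b i `^ q) `^ q^-1.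
Proof.
move=> a0 b0 p0 q0 pq.
set S := \sum_(i | P i) a i `^ p; set T := \sum_(i | P i) b i `^ q.
have normE c (u r : R) : 0 <= u -> 0 < c -> 0 < r ->
    (u / c `^ r^-1) `^ r = u `^ r / c.
  move=> u0 c0 r0; rewrite powRM ?invr_ge0 ?powR_ge0 // -powR_inv1 ?powR_ge0 //.
  by rewrite -!powRrM mulN1r mulrN mulVf ?gt_eqF // powR_inv1 // ltW.
(* A family of norm 0 cannot be normalized, but it vanishes. *)
have [S0|S_neq0] := eqVneq S 0.
  rewrite big1 ?mulr_ge0 ?powR_ge0 // => i Pi.
  by rewrite (sum_powR_eq0 _ _ S0) // mul0r.
have [T0|T_neq0] := eqVneq T 0.
  rewrite big1 ?mulr_ge0 ?powR_ge0 // => i Pi.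
  by rewrite (sum_powR_eq0 _ _ T0) // mulr0.
have S_gt0 : 0 < S.
  by rewrite lt_neqAle eq_sym S_neq0 sumr_ge0 // => *; exact: powR_ge0.
have T_gt0 : 0 < T.
  by rewrite lt_neqAle eq_sym T_neq0 sumr_ge0 // => *; exact: powR_ge0.
rewrite -[leRHS]mul1r -ler_pdivrMr ?mulr_gt0 ?powR_gt0 // mulr_suml.
have -> : 1 = \sum_(i | P i) (a i `^ p / S / p + b i `^ q / T / q).
  by rewrite big_split /= -!mulr_suml -/S -/T !divff // !mul1r pq.
apply: ler_sum => i _.
rewrite -(normE _ _ _ (a0 i) S_gt0 p0) -(normE _ _ _ (b0 i) T_gt0 q0).
rewrite invfM mulrACA; apply: conjugate_powR => //.
  by rewrite divr_ge0 ?powR_ge0.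
by rewrite divr_ge0 ?powR_ge0.
Qed.

End Hoelder.

Lemma row_abs_sum_ge0 (R : realType) (n : nat) (A : 'M[quat R]_n) (i : 'I_n) :
  0 <= row_abs_sum A i.
Proof. by apply: sumr_ge0 => j _; exact: qabs_ge0. Qed.

Lemma row_abs_sum_le_pnorm (R : realType) (n : nat) (A : 'M[quat R]_n)
    (i : 'I_n) (p q : R) : 0 < p -> 0 < q -> p^-1 + q^-1 = 1 ->
  row_abs_sum A i <= n.-1%:R `^ q^-1 * row_pnorm p A i.
Proof.
move=> p0 q0 pq.
have /= := @hoelder_sum R _ (fun j => j != i) (fun j => qabs (A i j))
  (fun=> 1) _ _ (fun=> qabs_ge0 _ _) (fun=> ler01) p0 q0 pq.
under eq_bigr do rewrite mulr1.
rewrite powR1 sumr_const (_ : #|_| = n.-1) 1?mulrC //.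
by have := cardC1 i; rewrite card_ord.
Qed.

Theorem theorem3p15 (R : realType) (n : nat) (A : 'M[quat R]_n) (gamma : R)
    (hgamma0 : 0 <= gamma) (hgamma1 : gamma <= 1)
    (p q : R) (hp : 1 < p) (hq : 1 < q) (hpq : p^-1 + q^-1 = 1) :
  left_eigenvalues A `<=` \bigcup_(i : 'I_n) gen_ball p q gamma A i.
Proof.
move=> l /left_gershgorin[i le_lr]; exists i => //=; apply: le_trans le_lr _.
have p0 : 0 < p := lt_trans ltr01 hp.
have q0 : 0 < q := lt_trans ltr01 hq.
have r0 := row_abs_sum_ge0 _ _ A i.
have d0 : 0 <= 1 - gamma by rewrite subr_ge0.
(* When the row sum is 0 the splitting still holds: the exponents add up to 1,
   so at least one of them is nonzero and its factor vanishes. *)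
rewrite [leLHS](_ : _
    = row_abs_sum A i `^ gamma * row_abs_sum A i `^ (1 - gamma)); last first.
  by rewrite -powRD addrC subrK ?powRr1 // oner_eq0.
rewrite [_ `^ ((1 - gamma) / q) * _]mulrC -mulrA ler_wpM2l ?powR_ge0 //.
rewrite [_ / q]mulrC powRrM -powRM ?powR_ge0 //.
apply: ge0_ler_powR; rewrite ?nnegrE ?mulr_ge0 ?powR_ge0 //.
exact: row_abs_sum_le_pnorm.
Qed.
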